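(* Let $\mathcal C$ be a homological category and let $\mathcal X$ be a full reflective subcategory of $\mathcal C$, with inclusion functor $U\colon \mathcal X\to\mathcal C$, reflector (left adjoint) $F\colon\mathcal C\to\mathcal X$, and associated localization functor $L=UF\colon\mathcal C\to\mathcal C$ with unit $\eta\colon 1_{\mathcal C}\Rightarrow L$. Assume that $L$ admits a functorial fiberwise localization. Then the following conditions are equivalent: (1) the localization $(L=UF,\eta)$ is conditionally flat; (2) the pullback of $\eta_C\colon C\to L(C)$ along any regular epimorphism in $\mathcal C$ between $L$-local objects is inverted by $L$; that is, for every object $C$ of $\mathcal C$ and every regular epimorphism $g\colon X\to L(C)$ in $\mathcal C$ with $X$ an $L$-local object, the functor $L$ sends the projection $C\times_{L(C)}X\to X$ to an isomorphism.
   Context: A category is regular if it is finitely complete, every morphism factors as a regular epimorphism followed by a monomorphism, and regular epimorphisms are stable under pullback. A homological category is a pointed regular category (zero object $0$) in which the Split Short Five Lemma holds: for any morphism $(u,v,w)$ between split epimorphisms (with chosen kernels, and compatible with the splittings), $u\colon K\to K'$ on kernels, $v\colon A\to A'$, $w\colon B\to B'$, if $u$ and $w$ are isomorphisms then so is $v$. An extension in $\mathcal C$ is a short exact sequence $0\to K\to E\to Q\to 0$ (the first map is a kernel of the second, the second is a cokernel of the first). An object $X$ is $L$-local if $\eta_X\colon X\to L(X)$ is an isomorphism (equivalently, $X$ is isomorphic to an object of $\mathcal X$). A morphism is inverted by $L$ if $L$ sends it to an isomorphism. An extension $0\to K\to E\to Q\to 0$ is $L$-flat if $0\to L(K)\to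 L(E)\to L(Q)\to 0$ is again an extension. The functor $L$ is conditionally flat if every pullback of an $L$-flat extension is $L$-flat: for every $L$-flat extension $0\to K\to E\to Q\to 0$ and every morphism $X\to Q$, the induced extension $0\to K\to E\times_Q X\to X\to 0$ is $L$-flat. An extension $0\to K\to E\to Q\to 0$ admits a fiberwise localization (with respect to $L$) if there is an extension $0\to L(K)\to\overline E\to Q\to 0$ and a morphism $e\colon E\to\overline E$ inverted by $L$ such that $(\eta_K,e,1_Q)$ is a morphism of extensions. The functor $L$ admits a functorial fiberwise localization if every extension is assigned a fiberwise localization in a functorial way: every morphism of extensions $(u,v,w)$ from $0\to K\to E\to Q\to 0$ to $0\to K'\to E'\to Q'\to 0$ is assigned a morphism $\overline v\colon\overline E\to\overline{E'}$ such that $(L(u),\overline v,w)$ is a morphism between the fiberwise localized extensions and $\overline v\circ e=e'\circ v$, and this assignment preserves identities and composition. *)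

(* Defs.v *)
From Stdlib Require Import FinFun.

Set Implicit Arguments.
Unset Strict Implicit.
Unset Printing Implicit Defensive.

(* Morphisms are compared with Leibniz equality. *)
Record category := Category {
  obj :> Type;
  hom : obj -> obj -> Type;
  idm : forall X, hom X X;
  comp : forall X Y Z, hom Y Z -> hom X Y -> hom X Z;
  comp_idl : forall X Y (f : hom X Y), comp (idm Y) f = f;
  comp_idr : forall X Y (f : hom X Y), comp f (idm X) = f;
  comp_assoc : forall W X Y Z (h : hom Y Z) (g : hom X Y) (f : hom W X),
    comp h (comp g f) = comp (comp h g) f
}.

Arguments idm {c} X.

Declare Scope cat_scope.
Open Scope cat_scope.
Notation "g ∘ f" := (comp g f) (at level 40, left associativity) : cat_scope.

Record functor (C D : category) := Functor {
  fobj :> C -> D;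
  fmap : forall X Y, hom X Y -> hom (fobj X) (fobj Y);
  fmap_id : forall X, fmap (idm X) = idm (fobj X);
  fmap_comp : forall X Y Z (g : hom Y Z) (f : hom X Y),
    fmap (g ∘ f) = fmap g ∘ fmap f
}.

Arguments fmap {C D} _ {X Y} _.

Definition id_functor (C : category) : functor C C :=
  @Functor C C (fun X => X) (fun X Y f => f)
    (fun X => eq_refl) (fun X Y Z g f => eq_refl).

Definition comp_functor (C D E : category) (G : functor D E) (F : functor C D) :
  functor C E.
Proof.
refine (@Functor C E (fun X => G (F X)) (fun X Y f => fmap G (fmap F f)) _ _).
- intros X; rewrite fmap_id; apply fmap_id.
- intros X Y Z g f; rewrite fmap_comp; apply fmap_comp.
Defined.

Record nat_trans (C D : category) (F G : functor C D) := NatTrans {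
  component :> forall X : C, hom (F X) (G X);
  naturality : forall (X Y : C) (f : hom X Y),
    component Y ∘ fmap F f = fmap G f ∘ component X
}.

Record adjunction (C D : category) (F : functor C D) (U : functor D C) :=
  Adjunction {
    adj_unit : nat_trans (id_functor C) (comp_functor U F);
    adj_counit : nat_trans (comp_functor F U) (id_functor D);
    triangle_left : forall X : C, adj_counit (F X) ∘ fmap F (adj_unit X) = idm (F X);
    triangle_right : forall Y : D, fmap U (adj_counit Y) ∘ adj_unit (U Y) = idm (U Y)
  }.

Definition full_subcategory (C : category) (P : C -> Prop) : category :=
  @Category {X : C | P X}
    (fun X Y => hom (proj1_sig X) (proj1_sig Y))
    (fun X => idm (proj1_sig X))
    (fun X Y Z g f => g ∘ f)
    (fun X Y f => comp_idl f)
    (fun X Y f => comp_idr f)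
    (fun W X Y Z h g f => comp_assoc h g f).

Definition inclusion (C : category) (P : C -> Prop) :
  functor (full_subcategory P) C :=
  @Functor (full_subcategory P) C (fun X => proj1_sig X) (fun X Y f => f)
    (fun X => eq_refl) (fun X Y Z g f => eq_refl).

Section Morphisms.

Variable C : category.

Definition is_iso (X Y : C) (f : hom X Y) : Prop :=
  exists g : hom Y X, g ∘ f = idm X /\ f ∘ g = idm Y.

Definition is_mono (X Y : C) (f : hom X Y) : Prop :=
  forall (W : C) (g h : hom W X), f ∘ g = f ∘ h -> g = h.

Definition is_coequalizer (X Y Q : C) (f g : hom X Y) (q : hom Y Q) : Prop :=
  q ∘ f = q ∘ g /\
  forall (Z : C) (h : hom Y Z), h ∘ f = h ∘ g ->
    exists! t : hom Q Z, t ∘ q = h.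

Definition is_regular_epi (Y Q : C) (q : hom Y Q) : Prop :=
  exists (X : C) (f g : hom X Y), is_coequalizer f g q.

(*  P --p2--> B
    |p1       |g
    A ---f--> Z  *)
Definition is_pullback (A B Z P : C) (f : hom A Z) (g : hom B Z)
    (p1 : hom P A) (p2 : hom P B) : Prop :=
  f ∘ p1 = g ∘ p2 /\
  forall (T : C) (a : hom T A) (b : hom T B), f ∘ a = g ∘ b ->
    exists! t : hom T P, p1 ∘ t = a /\ p2 ∘ t = b.

Definition is_initial (Z : C) : Prop := forall X : C, exists! f : hom Z X, True.
Definition is_terminal (Z : C) : Prop := forall X : C, exists! f : hom X Z, True.
Definition is_zero_object (Z : C) : Prop := is_initial Z /\ is_terminal Z.

Definition is_zero_mor (X Y : C) (f : hom X Y) : Prop :=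
  exists (Z : C) (a : hom X Z) (b : hom Z Y), is_zero_object Z /\ f = b ∘ a.

Definition is_kernel (K A B : C) (k : hom K A) (f : hom A B) : Prop :=
  is_zero_mor (f ∘ k) /\
  forall (T : C) (t : hom T A), is_zero_mor (f ∘ t) ->
    exists! s : hom T K, k ∘ s = t.

Definition is_cokernel (A B Q : C) (q : hom B Q) (f : hom A B) : Prop :=
  is_zero_mor (q ∘ f) /\
  forall (T : C) (t : hom B T), is_zero_mor (t ∘ f) ->
    exists! s : hom Q T, s ∘ q = t.

End Morphisms.

Definition finite_category (J : category) : Prop :=
  Finite J /\ forall X Y : J, Finite (hom X Y).

Definition is_cone (J C : category) (D : functor J C) (A : C)
    (leg : forall j : J, hom A (D j)) : Prop :=
  forall (i j : J) (f : hom i j), fmap D f ∘ leg i = leg j.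

Definition is_limit (J C : category) (D : functor J C) (A : C)
    (leg : forall j : J, hom A (D j)) : Prop :=
  is_cone leg /\
  forall (T : C) (t : forall j : J, hom T (D j)), is_cone t ->
    exists! s : hom T A, forall j : J, leg j ∘ s = t j.

Definition finitely_complete (C : category) : Prop :=
  forall (J : category) (D : functor J C), finite_category J ->
    exists (A : C) (leg : forall j : J, hom A (D j)), is_limit leg.

Record is_regular (C : category) : Prop := IsRegular {
  regular_finitely_complete : finitely_complete C;
  regular_factorization : forall (X Y : C) (f : hom X Y),
    exists (I : C) (m : hom I Y) (e : hom X I),
      is_regular_epi e /\ is_mono m /\ f = m ∘ e;
  regular_epi_stable : forall (A B Z P : C) (f : hom A Z) (g : hom B Z)
      (p1 : hom P A) (p2 : hom P B),
    is_pullback f g p1 p2 -> is_regular_epi f -> is_regular_epi p2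
}.

Definition split_short_five_lemma (C : category) : Prop :=
  forall (K A B K' A' B' : C)
    (k : hom K A) (p : hom A B) (s : hom B A)
    (k' : hom K' A') (p' : hom A' B') (s' : hom B' A')
    (u : hom K K') (v : hom A A') (w : hom B B'),
    is_kernel k p -> p ∘ s = idm B ->
    is_kernel k' p' -> p' ∘ s' = idm B' ->
    v ∘ k = k' ∘ u -> p' ∘ v = w ∘ p -> v ∘ s = s' ∘ w ->
    is_iso u -> is_iso w -> is_iso v.

Record is_homological (C : category) : Prop := IsHomological {
  homological_regular : is_regular C;
  homological_pointed : exists Z : C, is_zero_object Z;
  homological_split_short_five : split_short_five_lemma C
}.

Definition is_extension (C : category) (K E Q : C)
    (k : hom K E) (q : hom E Q) : Prop :=
  is_kernel k q /\ is_cokernel q k.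

Record extension (C : category) := Extension {
  ext_ker : C;
  ext_mid : C;
  ext_quo : C;
  ext_inj : hom ext_ker ext_mid;
  ext_proj : hom ext_mid ext_quo;
  ext_exact : is_extension ext_inj ext_proj
}.

Record ext_mor (C : category) (S T : extension C) := ExtMor {
  mor_ker : hom (ext_ker S) (ext_ker T);
  mor_mid : hom (ext_mid S) (ext_mid T);
  mor_quo : hom (ext_quo S) (ext_quo T);
  mor_inj : mor_mid ∘ ext_inj S = ext_inj T ∘ mor_ker;
  mor_proj : ext_proj T ∘ mor_mid = mor_quo ∘ ext_proj S
}.

Definition ext_mor_id (C : category) (S : extension C) : ext_mor S S.
Proof.
refine (@ExtMor C S S (idm _) (idm _) (idm _) _ _);
  now rewrite comp_idl, comp_idr.
Defined.

Definition ext_mor_comp (C : category) (S T V : extension C)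
    (n : ext_mor T V) (m : ext_mor S T) : ext_mor S V.
Proof.
refine (@ExtMor C S V (mor_ker n ∘ mor_ker m) (mor_mid n ∘ mor_mid m)
  (mor_quo n ∘ mor_quo m) _ _).
- now rewrite <- comp_assoc, mor_inj, comp_assoc, mor_inj, comp_assoc.
- now rewrite comp_assoc, mor_proj, <- comp_assoc, mor_proj, comp_assoc.
Defined.

Section Localization.

Variables (C : category) (L : functor C C) (eta : nat_trans (id_functor C) L).

Definition is_local (X : C) : Prop := is_iso (eta X).

Definition inverted (X Y : C) (f : hom X Y) : Prop := is_iso (fmap L f).

Definition flat_extension (K E Q : C) (k : hom K E) (q : hom E Q) : Prop :=
  is_extension k q /\ is_extension (fmap L k) (fmap L q).

Definition conditionally_flat : Prop :=
  forall (K E Q X P : C) (k : hom K E) (q : hom E Q) (x : hom X Q)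
    (p1 : hom P E) (p2 : hom P X) (k' : hom K P),
    flat_extension k q -> is_pullback q x p1 p2 ->
    p1 ∘ k' = k -> is_zero_mor (p2 ∘ k') ->
    flat_extension k' p2.

(* The equations say that (eta_K, floc_map, 1_Q) is a morphism of extensions. *)
Record fiberwise_localization (S : extension C) := FiberwiseLocalization {
  floc_mid : C;
  floc_inj : hom (L (ext_ker S)) floc_mid;
  floc_proj : hom floc_mid (ext_quo S);
  floc_exact : is_extension floc_inj floc_proj;
  floc_map : hom (ext_mid S) floc_mid;
  floc_map_inverted : inverted floc_map;
  floc_map_inj : floc_map ∘ ext_inj S = floc_inj ∘ eta (ext_ker S);
  floc_map_proj : floc_proj ∘ floc_map = idm (ext_quo S) ∘ ext_proj S
}.

Record functorial_fiberwise_localization := FunctorialFiberwiseLocalization {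
  ffl : forall S : extension C, fiberwise_localization S;
  ffl_mor : forall S T : extension C, ext_mor S T ->
    hom (floc_mid (ffl S)) (floc_mid (ffl T));
  ffl_mor_inj : forall (S T : extension C) (m : ext_mor S T),
    ffl_mor m ∘ floc_inj (ffl S) = floc_inj (ffl T) ∘ fmap L (mor_ker m);
  ffl_mor_proj : forall (S T : extension C) (m : ext_mor S T),
    floc_proj (ffl T) ∘ ffl_mor m = mor_quo m ∘ floc_proj (ffl S);
  ffl_mor_map : forall (S T : extension C) (m : ext_mor S T),
    ffl_mor m ∘ floc_map (ffl S) = floc_map (ffl T) ∘ mor_mid m;
  ffl_mor_id : forall S : extension C,
    ffl_mor (ext_mor_id S) = idm (floc_mid (ffl S));
  ffl_mor_comp : forall (S T V : extension C)
      (n : ext_mor T V) (m : ext_mor S T),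
    ffl_mor (ext_mor_comp n m) = ffl_mor n ∘ ffl_mor m
}.

End Localization.

(* Main.v *)
(* Conditional flatness is tested on the pullback W of an extension of local
   objects along a map L(X) -> L(Q).  Given a flat extension K -> E -> Q and its
   pullback K -> P -> X, the fiberwise localization L(K) -> P' -> X maps to the
   pullback of W = L(E) x_L(Q) L(X) -> L(X) along eta_X, with the identity on the
   kernel L(K) and on X; the Short Five Lemma makes this map invertible, so
   condition (2) says that P' -> W, and hence P -> W, is inverted by L.  As W is
   local, L(P) is W, and L(K) -> W -> L(X) is an extension.
   Conversely, for g : X -> L(A) as in (2), all terms of Ker(g) -> X -> L(A) are
   local, so this extension is flat; flatness of its pullback along eta_A and the
   Short Five Lemma show that L inverts the projection.
   The Split Short Five Lemma enters through the Short Five Lemma and through the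
   fact that a regular epimorphism is the cokernel of its kernel. *)
From Stdlib Require Import ssreflect ssrfun List.
Require Import Defs.

Set Implicit Arguments.
Unset Strict Implicit.
Unset Printing Implicit Defensive.

(** * Limits and zero morphisms *)

Section Limits.

Variable C : category.

Lemma pullback_lift (A B Z P : C) (f : hom A Z) (g : hom B Z)
    (p1 : hom P A) (p2 : hom P B) (T : C) (a : hom T A) (b : hom T B) :
  is_pullback f g p1 p2 -> f ∘ a = g ∘ b ->
  exists t : hom T P, p1 ∘ t = a /\ p2 ∘ t = b.
Proof. by move=> [_ H] /H [t [Ht _]]; exists t. Qed.

Lemma pullback_ext (A B Z P : C) (f : hom A Z) (g : hom B Z)
    (p1 : hom P A) (p2 : hom P B) (T : C) (s t : hom T P) :
  is_pullback f g p1 p2 -> p1 ∘ s = p1 ∘ t -> p2 ∘ s = p2 ∘ t -> s = t.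
Proof.
move=> [E H] E1 E2.
case: (H T (p1 ∘ t) (p2 ∘ t)); first by rewrite !comp_assoc E.
by move=> r [_ U]; rewrite -(U s) // -(U t).
Qed.

Lemma pullback_sym (A B Z P : C) (f : hom A Z) (g : hom B Z)
    (p1 : hom P A) (p2 : hom P B) :
  is_pullback f g p1 p2 -> is_pullback g f p2 p1.
Proof.
move=> [E H]; split=> // T a b /esym /H [t [[E1 E2] U]].
by exists t; split=> // s [E3 E4]; apply: U.
Qed.

Lemma kernel_lift (K A B : C) (k : hom K A) (f : hom A B) (T : C) (t : hom T A) :
  is_kernel k f -> is_zero_mor (f ∘ t) -> exists s : hom T K, k ∘ s = t.
Proof. by move=> [_ H] /H [s [Hs _]]; exists s. Qed.

Lemma zero_mor_compl (X Y Z : C) (f : hom X Y) (g : hom Y Z) :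
  is_zero_mor f -> is_zero_mor (g ∘ f).
Proof.
move=> [O [a [b [HO ->]]]].
by exists O, a, (g ∘ b); split=> //; rewrite comp_assoc.
Qed.

Lemma zero_mor_compr (X Y Z : C) (f : hom X Y) (g : hom Y Z) :
  is_zero_mor g -> is_zero_mor (g ∘ f).
Proof.
move=> [O [a [b [HO ->]]]].
by exists O, (a ∘ f), b; split=> //; rewrite comp_assoc.
Qed.

Lemma zero_mor_unique (X Y : C) (f g : hom X Y) :
  is_zero_mor f -> is_zero_mor g -> f = g.
Proof.
move=> [O [a [b [[_ tO] ->]]]] [O' [a' [b' [[iO' tO'] ->]]]].
have [z _] := iO' O.
have -> : a = z ∘ a' by case: (tO X) => c [_ U]; rewrite -(U a) // -(U (z ∘ a')).
rewrite comp_assoc; congr (_ ∘ _).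
by case: (iO' Y) => c [_ U]; rewrite -(U b') // -(U (b ∘ z)).
Qed.

Lemma kernel_mono (K A B : C) (k : hom K A) (f : hom A B) :
  is_kernel k f -> is_mono k.
Proof.
move=> [Z H] W g h E.
case: (H W (k ∘ h)); first by rewrite comp_assoc; apply: zero_mor_compr.
by move=> r [_ U]; rewrite -(U g) // -(U h).
Qed.

Lemma is_iso_comp (X Y Z : C) (f : hom X Y) (g : hom Y Z) :
  is_iso f -> is_iso g -> is_iso (g ∘ f).
Proof.
move=> [f' [E1 E2]] [g' [E3 E4]]; exists (f' ∘ g'); split.
- by rewrite -comp_assoc (comp_assoc g') E3 comp_idl.
- by rewrite -comp_assoc (comp_assoc f) E2 comp_idl.
Qed.

Lemma is_iso_id (X : C) : is_iso (idm X).
Proof. by exists (idm X); rewrite comp_idl. Qed.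

(** A map killed by [p2] is determined by its component along [p1], which [f] kills and which
    therefore factors through [k]. *)
Lemma kernel_of_pullback (K A B Z P : C) (f : hom A Z) (g : hom B Z)
    (p1 : hom P A) (p2 : hom P B) (k : hom K A) (k' : hom K P) :
  is_pullback f g p1 p2 -> is_kernel k f -> p1 ∘ k' = k ->
  is_zero_mor (p2 ∘ k') -> is_kernel k' p2.
Proof.
move=> pb kk E1 Z2; split=> // T t Zt.
have [s Es] : exists s, k ∘ s = p1 ∘ t.
  apply: (kernel_lift kk); rewrite comp_assoc (proj1 pb) -comp_assoc.
  exact: zero_mor_compl.
exists s; split.
  apply: (pullback_ext pb); first by rewrite comp_assoc E1.
  by apply: zero_mor_unique => //; rewrite comp_assoc; apply: zero_mor_compr.
by move=> s' Es'; apply: (kernel_mono kk); rewrite Es -Es' comp_assoc E1.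
Qed.

Lemma kernel_of_mono_comp (K A A' B : C) (k : hom K A) (f : hom A B)
    (m : hom A' A) (k' : hom K A') :
  is_mono m -> is_kernel k f -> m ∘ k' = k -> is_kernel k' (f ∘ m).
Proof.
move=> mm kk E; split; first by rewrite -comp_assoc E; case: kk.
move=> T t; rewrite -comp_assoc => /(kernel_lift kk) [s Es]; exists s; split.
  by apply: mm; rewrite comp_assoc E.
by move=> s' Es'; apply: (kernel_mono kk); rewrite Es -Es' comp_assoc E.
Qed.

Lemma kernel_conj_iso (K A B K' A' B' : C) (k : hom K A) (f : hom A B)
    (k' : hom K' A') (f' : hom A' B') (u : hom K K') (v : hom A A') (w : hom B B') :
  v ∘ k = k' ∘ u -> f' ∘ v = w ∘ f -> is_iso u -> is_iso v -> is_iso w ->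
  is_kernel k f -> is_kernel k' f'.
Proof.
move=> Ek Ef [u' [u1 u2]] [v' [v1 v2]] [w' [w1 w2]] kk; split.
  have -> : f' ∘ k' = w ∘ (f ∘ k ∘ u').
    by rewrite !comp_assoc -Ef -(comp_assoc f') Ek comp_assoc -comp_assoc u2 comp_idr.
  by apply/zero_mor_compl/zero_mor_compr; case: kk.
move=> T t Zt.
have [|s Es] := @kernel_lift _ _ _ _ _ _ (v' ∘ t) kk.
  have -> : f ∘ (v' ∘ t) = w' ∘ (f' ∘ t).
    rewrite -[t in RHS]comp_idl -v2 -(comp_assoc v) (comp_assoc f') Ef.
    by rewrite -(comp_assoc w) (comp_assoc w') w1 comp_idl.
  exact: zero_mor_compl.
exists (u ∘ s); split.
  by rewrite comp_assoc -Ek -comp_assoc Es comp_assoc v2 comp_idl.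
move=> s' Es'; rewrite -[s']comp_idl -u2 -comp_assoc; congr (_ ∘ _).
apply: (kernel_mono kk); rewrite Es -Es' -[k ∘ _]comp_idl -v1.
by rewrite -!comp_assoc (comp_assoc v) Ek -(comp_assoc k') (comp_assoc u) u2 comp_idl.
Qed.

(** The pair that [q] is known to coequalize factors through the kernel pair, so a map coequalizing
    [r1] and [r2] also coequalizes that pair. *)
Lemma kernel_pair_coequalizer (E Q R : C) (q : hom E Q) (r1 r2 : hom R E) :
  is_regular_epi q -> is_pullback q q r1 r2 -> is_coequalizer r1 r2 q.
Proof.
move=> [X [f [g [Efg U]]]] pb; split; first by case: pb.
move=> Z h Eh; apply: U; have [t [<- <-]] := pullback_lift pb Efg.
by rewrite !comp_assoc Eh.
Qed.

(** Since [m] is monic, [p] already coequalizes the pair defining [m ∘ p]; the map that [p] induces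
    on the quotient is the inverse of [m]. *)
Lemma regular_epi_through_mono (X Y Z : C) (p : hom X Y) (m : hom Y Z) :
  is_regular_epi (m ∘ p) -> is_mono m -> is_iso m.
Proof.
move=> [W [f [g [Efg U]]]] mm.
have Ep : p ∘ f = p ∘ g by apply: mm; rewrite !comp_assoc.
have [t [Et _]] := U _ _ Ep.
have E1 : m ∘ t = idm Z.
  have [c [_ Uc]] := U _ _ Efg.
  by rewrite -(Uc (m ∘ t)) ?(Uc (idm Z)) ?comp_idl // -comp_assoc Et.
by exists t; split=> //; apply: mm; rewrite comp_assoc E1 comp_idl comp_idr.
Qed.

Lemma is_iso_precomp_regular_epi (X Y Z : C) (q : hom Y Z) (i : hom X Y) :
  is_iso i -> is_regular_epi q -> is_regular_epi (q ∘ i).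
Proof.
move=> [j [E1 E2]] [W [f [g [Efg U]]]]; exists W, (j ∘ f), (j ∘ g).
have qij T (f' : hom T Y) : q ∘ i ∘ (j ∘ f') = q ∘ f'.
  by rewrite -comp_assoc (comp_assoc i) E2 comp_idl.
split; first by rewrite !qij.
move=> T h; rewrite !comp_assoc => /U [t [Et Ut]]; exists t; split.
  by rewrite comp_assoc Et -comp_assoc E1 comp_idr.
by move=> t' Et'; apply: Ut; rewrite -Et' comp_assoc -comp_assoc E2 comp_idr.
Qed.

End Limits.

(** * Pullbacks from finite limits *)

Section Cospan.

(** The feet of the cospan are [Some true] and [Some false], its apex is [None]. Each hom type has
    at most one element, which yields all category laws. *)
Definition cospan_hom (i j : option bool) : Type :=
  match i, j with
  | None, None | Some true, Some true | Some false, Some false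
  | Some _, None => unit
  | _, _ => Empty_set
  end.

Lemma cospan_hom_unique i j (f g : cospan_hom i j) : f = g.
Proof. by case: i f g => [[]|]; case: j => [[]|] [] []. Qed.

Definition cospan_id i : cospan_hom i i :=
  match i with Some true | Some false | None => tt end.

Definition cospan_comp i j k : cospan_hom j k -> cospan_hom i j -> cospan_hom i k.
Proof. by case: i => [[]|]; case: j => [[]|]; case: k => [[]|] [] []. Defined.

Definition cospan : category :=
  @Category (option bool) cospan_hom cospan_id cospan_comp
    (fun _ _ _ => cospan_hom_unique _ _) (fun _ _ _ => cospan_hom_unique _ _)
    (fun _ _ _ _ _ _ _ => cospan_hom_unique _ _).

Lemma cospan_finite : finite_category cospan.
Proof.
split; first by exists (Some true :: Some false :: None :: nil) => -[[]|] /=; tauto.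
move=> [[]|] [[]|]; by [exists nil; case | exists (tt :: nil); case; left].
Qed.

Variables (C : category) (A B Z : C) (f : hom A Z) (g : hom B Z).

Definition cospan_obj (i : cospan) : C :=
  match i with Some true => A | Some false => B | None => Z end.

Definition cospan_map (i j : cospan) : hom i j -> hom (cospan_obj i) (cospan_obj j) :=
  match i, j with
  | None, None => fun _ => idm Z
  | Some true, Some true => fun _ => idm A
  | Some false, Some false => fun _ => idm B
  | Some true, None => fun _ => f
  | Some false, None => fun _ => g
  | _, _ => fun h => match h with end
  end.

Definition cospan_functor : functor cospan C.
Proof.
refine (@Functor cospan C cospan_obj cospan_map _ _).
- by move=> [[]|].
- by move=> [[]|] [[]|] [[]|] [] [] /=; rewrite ?comp_idl ?comp_idr.
Defined.

Lemma pullback_exists : finitely_complete C ->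
  exists (P : C) (p1 : hom P A) (p2 : hom P B), is_pullback f g p1 p2.
Proof.
move=> /(_ _ cospan_functor cospan_finite) [P [leg [cl ul]]].
have cE1 := cl (Some true) None tt; have cE2 := cl (Some false) None tt.
exists P, (leg (Some true)), (leg (Some false)).
split; first exact: (eq_trans cE1 (esym cE2)).
move=> T a b E.
pose t (j : cospan) : hom T (cospan_functor j) :=
  match j with Some true => a | Some false => b | None => f ∘ a end.
have tc : is_cone t.
  by move=> [[]|] [[]|] [] /=; rewrite ?comp_idl.
have [s [Es Us]] := ul _ _ tc; exists s; split.
  by split; [exact: (Es (Some true)) | exact: (Es (Some false))].
move=> s' [E1 E2]; apply: Us => -[[]|] //.
by rewrite -cE1 /= -E1 comp_assoc.
Qed.

End Cospan.

(** * Kernels and equalizers from pullbacks *)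

Section FiniteLimits.

Variables (C : category).

Lemma zero_mor_exists (X Y : C) : (exists Z : C, is_zero_object Z) ->
  exists z : hom X Y, is_zero_mor z.
Proof.
move=> [O [iO tO]]; have [a _] := tO X; have [b _] := iO Y.
by exists (b ∘ a), O, a, b.
Qed.

Lemma kernel_exists (A B : C) (f : hom A B) : finitely_complete C ->
  (exists Z : C, is_zero_object Z) -> exists (K : C) (k : hom K A), is_kernel k f.
Proof.
move=> lim [O zO]; case: (zO) => iO tO; have [b _] := iO B.
have [K [k [o pb]]] := pullback_exists f b lim.
exists K, k; split; first by exists O, o, b; split=> //; case: pb.
move=> T t Zt; have [a _] := tO T.
have [|s [Es _]] := @pullback_lift _ _ _ _ _ _ _ _ _ _ t a pb.
  by apply: zero_mor_unique => //; exists O, a, b.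
exists s; split=> // s' Es'; apply: (pullback_ext pb); first by rewrite Es.
by have [c [_ U]] := tO T; rewrite -(U (o ∘ s)) // -(U (o ∘ s')).
Qed.

(** The equalizer is the pullback of the pairing of [f] and [g] along the diagonal of T × T, where
    the product is a pullback over the zero object. *)
Lemma equalizer_exists (R T : C) (f g : hom R T) : finitely_complete C ->
  (exists Z : C, is_zero_object Z) ->
  exists (E : C) (m : hom E R), is_mono m /\ f ∘ m = g ∘ m /\
    forall (W : C) (h : hom W R), f ∘ h = g ∘ h -> exists t, m ∘ t = h.
Proof.
move=> lim [O [iO tO]]; have [o _] := tO T.
have oE W (a b : hom W O) : a = b.
  by have [c [_ U]] := tO W; rewrite -(U a) // -(U b).
have [TT [p1 [p2 pT]]] := pullback_exists o o lim.
have [fg [E1 E2]] := pullback_lift pT (oE _ (o ∘ f) (o ∘ g)).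
have [d [E3 E4]] := pullback_lift pT (oE _ (o ∘ idm T) (o ∘ idm T)).
have [E [m [n pE]]] := pullback_exists fg d lim.
have mn : f ∘ m = n /\ g ∘ m = n.
  by rewrite -E1 -E2 -!comp_assoc (proj1 pE) !comp_assoc E3 E4 !comp_idl.
exists E, m; split; last split.
- move=> W a b Eab; apply: (pullback_ext pE) => //.
  by case: mn => <- _; rewrite -!comp_assoc Eab.
- by case: mn => -> ->.
- move=> W h Eh; have [|t [Et _]] := @pullback_lift _ _ _ _ _ _ _ _ _ _ h (f ∘ h) pE.
    by apply: (pullback_ext pT);
      rewrite !comp_assoc ?E1 ?E2 ?E3 ?E4 comp_idl.
  by exists t.
Qed.

Lemma pullback_kernel (K A B Z P : C) (f : hom A Z) (g : hom B Z)
    (p1 : hom P A) (p2 : hom P B) (k : hom K A) :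
  (exists Z : C, is_zero_object Z) ->
  is_pullback f g p1 p2 -> is_kernel k f ->
  exists k' : hom K P,
    p1 ∘ k' = k /\ is_zero_mor (p2 ∘ k') /\ is_kernel k' p2.
Proof.
move=> pt pb kk; have [z Zz] := zero_mor_exists K B pt.
have [|k' [E1 E2]] := @pullback_lift _ _ _ _ _ _ _ _ _ _ k z pb.
  by apply: zero_mor_unique; [case: kk | apply: zero_mor_compl].
have Z2 : is_zero_mor (p2 ∘ k') by rewrite E2.
by exists k'; split=> //; split=> //; apply: (kernel_of_pullback pb kk).
Qed.

(** A cokernel of [f] is a coequalizer of [f] and the zero map. *)
Lemma cokernel_regular_epi (A B Q : C) (q : hom B Q) (f : hom A B) :
  (exists Z : C, is_zero_object Z) -> is_cokernel q f -> is_regular_epi q.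
Proof.
move=> pt [Zq U]; have [z Zz] := zero_mor_exists A B pt; exists A, f, z; split.
  by apply: zero_mor_unique => //; apply: zero_mor_compl.
by move=> T h Eh; apply: U; rewrite Eh; apply: zero_mor_compl.
Qed.

End FiniteLimits.

(** * Regular epimorphisms in homological categories *)

Section Homological.

Variables (C : category) (hC : is_homological C).

Let lim : finitely_complete C := regular_finitely_complete (homological_regular hC).
Let pt := homological_pointed hC.

(* Protomodularity: the equalizer of f and g contains both the kernel and the
   section, so the Split Short Five Lemma makes its inclusion invertible. *)
Lemma split_epi_jointly_epic (K A B T : C) (k : hom K A) (p : hom A B)
    (s : hom B A) (f g : hom A T) :
  is_kernel k p -> p ∘ s = idm B -> f ∘ k = g ∘ k -> f ∘ s = g ∘ s -> f = g.
Proof.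
move=> kk ps Ek Es.
have [E [m [mm [Em Um]]]] := equalizer_exists f g lim pt.
have [k' Ek'] := Um _ _ Ek; have [s' Es'] := Um _ _ Es.
have [n [_ E2]] : is_iso m.
{ apply: (homological_split_short_five hC (k := k') (p := p ∘ m) (s := s')
    (k' := k) (p' := p) (s' := s) (u := idm K) (w := idm B)) => //.
  - exact: (kernel_of_mono_comp mm kk).
  - by rewrite -comp_assoc Es'.
  - by rewrite comp_idr.
  - by rewrite comp_idl.
  - by rewrite comp_idr.
  - exact: is_iso_id.
  - exact: is_iso_id. }
by rewrite -[f]comp_idr -E2 comp_assoc Em -comp_assoc E2 comp_idr.
Qed.

(** A map [t] vanishing on [k] must coequalize the kernel pair of [q]. The composites [t ∘ r1] and
    [t ∘ r2] agree on the kernel of [r2], where both vanish, and on the diagonal, a section of [r2];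
    these two are jointly epic. *)
Lemma regular_epi_extension (K E Q : C) (k : hom K E) (q : hom E Q) :
  is_kernel k q -> is_regular_epi q -> is_extension k q.
Proof.
move=> kk rq; split=> //; split; first by case: kk.
move=> T t Zt.
have [R [r1 [r2 pb]]] := pullback_exists q q lim.
have [d [E1 E2]] := pullback_lift pb (erefl (q ∘ idm E)).
have [k' [E3 [Z4 kk']]] := pullback_kernel pt pb kk.
apply: (proj2 (kernel_pair_coequalizer rq pb)).
apply: (split_epi_jointly_epic kk' E2).
- rewrite -!comp_assoc E3; apply: zero_mor_unique => //.
  exact: zero_mor_compl.
- by rewrite -!comp_assoc E1 E2.
Qed.

(* Pulling back along q turns both rows into split epimorphisms, so the pullback
   of v along the regular epimorphism E' x_Q E -> E' is invertible. *)
Lemma short_five (K E E' Q : C) (k : hom K E) (q : hom E Q)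
    (k' : hom K E') (q' : hom E' Q) (v : hom E E') :
  is_kernel k q -> is_regular_epi q -> is_kernel k' q' ->
  v ∘ k = k' -> q' ∘ v = q -> is_iso v.
Proof.
move=> kk rq kk' vk qv.
have [R [r1 [r2 pR]]] := pullback_exists q q lim.
have [S [s1 [s2 pS]]] := pullback_exists q' q lim.
have [d [d1 d2]] := pullback_lift pR (erefl (q ∘ idm E)).
have [|d' [d'1 d'2]] := @pullback_lift _ _ _ _ _ _ _ _ _ _ v (idm E) pS.
  by rewrite comp_idr.
have [j [j1 [Zj kj]]] := pullback_kernel pt pR kk.
have [j' [j'1 [Zj' kj']]] := pullback_kernel pt pS kk'.
have [|c [c1 c2]] := @pullback_lift _ _ _ _ _ _ _ _ _ _ (v ∘ r1) r2 pS.
  by rewrite comp_assoc qv; case: pR.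
have ic : is_iso c.
{ apply: (homological_split_short_five hC (k := j) (p := r2) (s := d)
    (k' := j') (p' := s2) (s' := d') (u := idm K) (w := idm E)) => //.
  - rewrite comp_idr; apply: (pullback_ext pS).
      by rewrite comp_assoc c1 -comp_assoc j1 j'1.
    by apply: zero_mor_unique => //; rewrite comp_assoc c2.
  - by rewrite comp_idl.
  - rewrite comp_idr; apply: (pullback_ext pS).
      by rewrite comp_assoc c1 -comp_assoc d1 d'1 comp_idr.
    by rewrite comp_assoc c2 d2 d'2.
  - exact: is_iso_id.
  - exact: is_iso_id. }
(* The composite [v ∘ r1] equals [s1 ∘ c], with [s1] a pullback of [q] and [c] invertible, so it is
   a regular epimorphism; it remains to see that [v] is monic. *)
apply: (@regular_epi_through_mono _ _ _ _ r1).
  rewrite -c1; apply: is_iso_precomp_regular_epi => //.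
  exact: (regular_epi_stable (homological_regular hC) (pullback_sym pS)).
(* If [v ∘ a = v ∘ b], the maps (a, a) and (b, a) into the kernel pair [R] become equal after the
   invertible [c]. *)
move=> T a b Eab.
have Eq : q ∘ a = q ∘ b by rewrite -qv -!comp_assoc Eab.
have [x [x1 x2]] := pullback_lift pR (erefl (q ∘ a)).
have [y [y1 y2]] := pullback_lift pR (esym Eq).
have Exy : c ∘ x = c ∘ y.
  apply: (pullback_ext pS); rewrite !comp_assoc ?c1 ?c2 ?x2 ?y2 //.
  by rewrite -!comp_assoc x1 y1.
rewrite -x1 -y1; congr (_ ∘ _).
by case: ic => c' [Ec _]; rewrite -[x]comp_idl -Ec -comp_assoc Exy comp_assoc Ec comp_idl.
Qed.

End Homological.

(** * Reflective localizations *)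

(** Only uniqueness of extensions along [eta X] is recorded: their existence for local targets
    follows from naturality of [eta]. *)
Definition reflection (C : category) (L : functor C C)
    (eta : nat_trans (id_functor C) L) : Prop :=
  (forall X : C, is_local eta (L X)) /\
  forall (X Y : C) (a b : hom (L X) Y), is_local eta Y ->
    a ∘ eta X = b ∘ eta X -> a = b.

Lemma adjunction_reflection (C : category) (isX : C -> Prop)
    (F : functor C (full_subcategory isX)) (adj : adjunction F (inclusion isX)) :
  reflection (adj_unit adj : nat_trans _ (comp_functor (inclusion isX) F)).
Proof.
pose L := comp_functor (inclusion isX) F.
pose eta := adj_unit adj : nat_trans (id_functor C) L.
have uniq X Y (a b : hom (L X) (L Y)) : a ∘ eta X = b ∘ eta X -> a = b.
  (* By fullness [h] is a morphism of the subcategory, so naturality of the counit and the left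
     triangle identity recover it from [h ∘ eta X]. *)
  have aE (h : hom (L X) (L Y)) :
      h = (adj_counit adj (F Y) : hom (L (L Y)) (L Y)) ∘ fmap L (h ∘ eta X).
    rewrite fmap_comp comp_assoc.
    have /= -> := naturality (adj_counit adj) (h : @hom (full_subcategory isX) _ _).
    rewrite -comp_assoc; have /= -> := triangle_left adj X.
    by rewrite comp_idr.
  by move=> E; rewrite (aE a) E -aE.
have idem X : is_local eta (L X).
  have E := triangle_right adj (F X); rewrite /= in E.
  exists (adj_counit adj (F X)); split; first exact: E.
  apply: uniq; rewrite -comp_assoc.
  by etransitivity; first (apply: f_equal; exact: E); rewrite comp_idl comp_idr.
split=> // X Y a b [r [E _]] Eab.
rewrite -[a]comp_idl -[b]comp_idl -E -!comp_assoc; congr (_ ∘ _).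
by apply: uniq; rewrite -!comp_assoc Eab.
Qed.

(** * Local objects and inverted morphisms *)

Section Reflection.

Variables (C : category) (L : functor C C) (eta : nat_trans (id_functor C) L).

Lemma local_of_retraction (X : C) (r : hom (L X) X) :
  reflection eta -> r ∘ eta X = idm X -> is_local eta X.
Proof.
move=> [idem uniq] E; exists r; split=> //; apply: uniq => //.
by rewrite -comp_assoc E comp_idl comp_idr.
Qed.

(** Cancelling the invertible [fmap L e] gives [fmap L a = fmap L b], and naturality of [eta] at the
    local object [Y] recovers [a] and [b]. *)
Lemma inverted_ext (A B Y : C) (e : hom A B) (a b : hom B Y) :
  inverted L e -> is_local eta Y -> a ∘ e = b ∘ e -> a = b.
Proof.
move=> [e' [_ E2]] [r [Er _]] Eab.
have EL : fmap L a = fmap L b.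
  by rewrite -[fmap L a]comp_idr -E2 comp_assoc -fmap_comp Eab fmap_comp
    -comp_assoc E2 comp_idr.
rewrite -[a]comp_idl -[b]comp_idl -Er -!comp_assoc; congr (_ ∘ _).
by have /= -> := naturality eta a; have /= -> := naturality eta b; rewrite EL.
Qed.

Lemma local_extend (A Y : C) (f : hom A Y) :
  is_local eta Y -> exists g : hom (L A) Y, g ∘ eta A = f.
Proof.
move=> [r [Er _]]; exists (r ∘ fmap L f).
by rewrite -comp_assoc -naturality /= comp_assoc Er comp_idl.
Qed.

Lemma inverted_extend (A B Y : C) (e : hom A B) (f : hom A Y) :
  inverted L e -> is_local eta Y -> exists g : hom B Y, g ∘ e = f.
Proof.
move=> [e' [E1 _]] /(local_extend f) [g <-]; exists (g ∘ e' ∘ eta B).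
rewrite -!comp_assoc; have /= -> := naturality eta e.
by rewrite (comp_assoc e') E1 comp_idl.
Qed.

(** The extension of [k] along [eta K] is still killed by [f], by uniqueness, so it factors through
    [k]; the factor is a retraction of [eta K]. *)
Lemma local_kernel (K A B : C) (k : hom K A) (f : hom A B) :
  reflection eta -> is_kernel k f -> (exists Z : C, is_zero_object Z) ->
  is_local eta A -> is_local eta B -> is_local eta K.
Proof.
move=> re kk pt lA lB; case: (re) => _ uniq.
have [g Eg] := local_extend k lA.
have [z Zz] := zero_mor_exists (L K) B pt.
have [|r Er] := @kernel_lift _ _ _ _ _ _ _ g kk.
  suff -> : f ∘ g = z by [].
  apply: uniq => //; rewrite -comp_assoc Eg; apply: zero_mor_unique.
    by case: kk.
  exact: zero_mor_compr.
apply: (local_of_retraction (r := r)) => //; apply: (kernel_mono kk).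
by rewrite comp_assoc Er Eg comp_idr.
Qed.

Lemma local_pullback (A B Z P : C) (f : hom A Z) (g : hom B Z)
    (p1 : hom P A) (p2 : hom P B) :
  reflection eta -> is_pullback f g p1 p2 ->
  is_local eta A -> is_local eta B -> is_local eta Z -> is_local eta P.
Proof.
move=> re pb lA lB lZ; case: (re) => _ uniq.
have [a Ea] := local_extend p1 lA; have [b Eb] := local_extend p2 lB.
have [|r [E1 E2]] := @pullback_lift _ _ _ _ _ _ _ _ _ _ a b pb.
  by apply: uniq => //; rewrite -!comp_assoc Ea Eb; case: pb.
apply: (local_of_retraction (r := r)) => //.
by apply: (pullback_ext pb); rewrite comp_assoc ?E1 ?E2 comp_idr.
Qed.

(** The components of [eta] form an isomorphism from the extension to its image under [L], along
    which the kernel and the regular epimorphism are transported. *)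
Lemma local_extension_flat (K E Q : C) (k : hom K E) (q : hom E Q) :
  is_homological C -> is_extension k q ->
  is_local eta K -> is_local eta E -> is_local eta Q -> flat_extension L k q.
Proof.
move=> hC ex lK lE lQ; split=> //; case: (ex) => kk ck.
have pt := homological_pointed hC.
apply: (regular_epi_extension hC).
  by apply: (kernel_conj_iso (u := eta K) (v := eta E) (w := eta Q)) kk => //;
    rewrite -naturality.
have [m [mE Em]] := lE; have [n [nE nQ]] := lQ.
have := cokernel_regular_epi pt ck.
move=> [X [f [g [Efg U]]]]; exists X, (eta E ∘ f), (eta E ∘ g); split.
  by rewrite !comp_assoc -!naturality /= -!comp_assoc Efg.
move=> T h; rewrite !comp_assoc => /U [t [Et Ut]]; exists (t ∘ n); split.
  have EE : n ∘ fmap L q = q ∘ m.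
    rewrite -[fmap L q]comp_idr -Em (comp_assoc (fmap L q)) -naturality /=.
    by rewrite !comp_assoc nE comp_idl.
  by rewrite -comp_assoc EE comp_assoc Et -comp_assoc Em comp_idr.
move=> t' Et'; rewrite (Ut (t' ∘ eta Q)) -?comp_assoc ?nQ ?comp_idr //.
by have /= -> := naturality eta q; rewrite comp_assoc Et'.
Qed.

(** * The two implications of the equivalence *)

Lemma conditionally_flat_inverts (A X P : C) (g : hom X (L A))
    (p1 : hom P A) (p2 : hom P X) :
  is_homological C -> reflection eta -> conditionally_flat L ->
  is_regular_epi g -> is_local eta X -> is_pullback (eta A) g p1 p2 ->
  inverted L p2.
Proof.
move=> hC re cf rg lX pb; case: (re) => idem uniq.
have pt := homological_pointed hC.
have lim := regular_finitely_complete (homological_regular hC).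
have [K [k kk]] := kernel_exists g lim pt.
have lK := local_kernel re kk pt lX (idem A).
have fl := local_extension_flat hC (regular_epi_extension hC kk rg) lK lX (idem A).
have [k' [E1 [Z2 kk']]] := pullback_kernel pt (pullback_sym pb) kk.
have [_ [kL cL]] := cf _ _ _ _ _ _ _ _ _ _ _ fl (pullback_sym pb) E1 Z2.
(* With [x] and [n] inverse to [eta X] and [eta K], the map [x ∘ fmap L p2] compares the extensions
   L(K) → L(P) → L(A) and L(K) → X → L(A), and is the identity on both ends. *)
have [x [x1 x2]] := lX; have [n [n1 n2]] := lK.
have Ep : g ∘ (x ∘ fmap L p2) = fmap L p1.
  apply: uniq => //; rewrite -!comp_assoc -naturality /= (comp_assoc x) x1 comp_idl.
  by rewrite -(proj1 pb); apply: (naturality eta p1).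
have Ek : x ∘ fmap L p2 ∘ fmap L k' = k ∘ n.
  rewrite -comp_assoc -fmap_comp E1; apply: uniq => //.
  by rewrite -!comp_assoc n1 -naturality /= comp_assoc x1 comp_idl comp_idr.
have iv : is_iso (x ∘ fmap L p2).
{ apply: (short_five hC kL (cokernel_regular_epi pt cL) (k' := k ∘ n) (q' := g)) => //.
  apply: (kernel_conj_iso (u := eta K) (v := idm X) (w := idm (L A))) kk => //.
  - by rewrite -comp_assoc n1 comp_idl comp_idr.
  - by rewrite comp_idl comp_idr.
  - exact: is_iso_id.
  - exact: is_iso_id. }
rewrite /inverted.
have -> : fmap L p2 = eta X ∘ (x ∘ fmap L p2) by rewrite comp_assoc x2 comp_idl.
exact: is_iso_comp.
Qed.

Lemma inverts_conditionally_flat :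
  is_homological C -> reflection eta ->
  (forall S : extension C, inhabited (fiberwise_localization eta S)) ->
  (forall (A X P : C) (g : hom X (L A)) (p1 : hom P A) (p2 : hom P X),
     is_regular_epi g -> is_local eta X ->
     is_pullback (eta A) g p1 p2 -> inverted L p2) ->
  conditionally_flat L.
Proof.
move=> hC re fl inv K E Q X P k q x p1 p2 k' [[kk ck] [kL cL]] pb E1 Z2.
case: (re) => idem uniq.
have pt := homological_pointed hC.
have reg := homological_regular hC; have lim := regular_finitely_complete reg.
have rp2 := regular_epi_stable reg pb (cokernel_regular_epi pt ck).
have exP := regular_epi_extension hC (kernel_of_pullback pb kk E1 Z2) rp2.
split; first exact: exP.
have [[Pb i pbar [ki ci] e ie ei /= ep]] := fl (Extension exP).
cbn in *; rewrite comp_idl in ep.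
have [W [w1 [w2 pW]]] := pullback_exists (fmap L q) (fmap L x) lim.
have lW := local_pullback re pW (idem E) (idem X) (idem Q).
have rw2 := regular_epi_stable reg pW (cokernel_regular_epi pt cL).
have [kw [kw1 [Zkw kkw]]] := pullback_kernel pt pW kL.
(* Pulling W → L(X) back along [eta X] leaves the kernel L(K) unchanged, so [P'] can be compared
   with the fiberwise localization [Pb]. *)
have [P' [s1 [s2 pP']]] := pullback_exists (eta X) w2 lim.
have [j [j2 [Zj kj]]] := pullback_kernel pt (pullback_sym pP') kkw.
have [|f [f1 f2]] := @pullback_lift _ _ _ _ _ _ _ _ _ _ (eta E ∘ p1) (eta X ∘ p2) pW.
  by rewrite !comp_assoc -!naturality /= -!comp_assoc (proj1 pb).
have f1k : w1 ∘ f ∘ k' = fmap L k ∘ eta K.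
  by rewrite f1 -comp_assoc E1 -naturality.
(* As [e] is inverted and [W] is local, the comparison [f] from [P] to [W] extends to [Pb], and this
   extension lifts to [c] from [Pb] to [P']. *)
have [fb Efb] := inverted_extend f ie lW.
have w2fb : eta X ∘ pbar = w2 ∘ fb.
  by apply: (inverted_ext ie) => //; rewrite -!comp_assoc ep Efb.
have [c [c1 c2]] := pullback_lift pP' w2fb.
have ic : is_iso c.
  apply: (short_five hC ki (cokernel_regular_epi pt ci) kj) => //.
  apply: (pullback_ext pP').
    by apply: zero_mor_unique => //; rewrite comp_assoc c1; case: ki.
  rewrite comp_assoc c2 j2; apply: (pullback_ext pW).
    rewrite kw1; apply: uniq => //.
    by rewrite -!comp_assoc -ei (comp_assoc fb) Efb comp_assoc f1k.
  apply: zero_mor_unique => //; rewrite comp_assoc -w2fb -comp_assoc.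
  by apply: zero_mor_compl; case: ki.
(* Condition (2) is applied to the regular epimorphism [w2] from the local object [W] to L(X). *)
have iS : is_iso (fmap L s2) := inv _ _ _ _ _ _ rw2 lW pP'.
(* Here [f] is the composite of [e], [c] and [s2], each inverted by [L]. *)
have iLf : is_iso (fmap L f).
  rewrite -Efb -c2 !fmap_comp; apply: is_iso_comp => //; apply: is_iso_comp => //.
  case: ic => c' [a b]; exists (fmap L c').
  by rewrite -!fmap_comp a b !fmap_id.
have [r [r1 r2]] := lW.
(* The isomorphism [v] from L(P) to [W] will carry [fmap L k'] and [fmap L p2] to [kw] and [w2],
   whose exactness is known. *)
have [v [iv vE]] : exists v, is_iso v /\ v ∘ eta P = f.
  exists (r ∘ fmap L f); split; first by apply: is_iso_comp => //; exists (eta W).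
  by rewrite -comp_assoc -naturality /= comp_assoc r1 comp_idl.
have w2v : w2 ∘ v = fmap L p2.
  by apply: uniq => //; rewrite -comp_assoc vE f2; apply: (naturality eta p2).
have vk : v ∘ fmap L k' = kw.
  have vkE : v ∘ fmap L k' ∘ eta K = f ∘ k'.
    by rewrite -comp_assoc -naturality /= comp_assoc vE.
  apply: (pullback_ext pW).
    rewrite kw1; apply: uniq => //.
    by rewrite -comp_assoc vkE comp_assoc f1k.
  apply: uniq => //; rewrite -!comp_assoc (comp_assoc v) vkE.
  apply: zero_mor_unique.
    by rewrite comp_assoc f2 -comp_assoc; apply: zero_mor_compl.
  by rewrite comp_assoc; apply: zero_mor_compr.
apply: (regular_epi_extension hC).
  rewrite -w2v; apply: (kernel_of_mono_comp _ kkw vk).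
  case: iv => v' [v1 _] T a b Eab.
  by rewrite -[a]comp_idl -v1 -comp_assoc Eab comp_assoc v1 comp_idl.
by rewrite -w2v; apply: is_iso_precomp_regular_epi.
Qed.

End Reflection.

Theorem proposition3p4
    (C : category) (hC : is_homological C)
    (isX : C -> Prop)
    (F : functor C (full_subcategory isX))
    (adj : adjunction F (inclusion isX))
    (L := comp_functor (inclusion isX) F)
    (eta := adj_unit adj : nat_trans (id_functor C) L)
    (hL : inhabited (functorial_fiberwise_localization eta)) :
  conditionally_flat L <->
  (forall (A X P : C) (g : hom X (L A)) (p1 : hom P A) (p2 : hom P X),
     is_regular_epi g -> is_local eta X ->
     is_pullback (eta A) g p1 p2 ->
     inverted L p2).
Proof.
have re : reflection eta := adjunction_reflection adj.
split.
  by move=> cf A X P g p1 p2; apply: conditionally_flat_inverts.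
apply: (inverts_conditionally_flat hC re).
by case: hL => ffl0 S; constructor; apply: ffl.
Qed.
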